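(* Let $(\mathcal{S},\Sigma,ar,coar)$ be a closed monoidal signature and let $\mathscr{C}_\Sigma$ be the category of string diagrams with brackets over it (defined in the context). Then $\mathscr{C}_\Sigma$, with monoidal product given by concatenation of words on objects and by $\otimes$ on terms, monoidal unit the empty word $I$, and symmetry given by the terms $\sigma_{X,Y}$, is a closed symmetric monoidal category.
   Context: Words. Given a set $\mathcal{S}$ of sorts, define covariant words $X$, contravariant words $X^\ast$ and mixed words $\mathbf{X}$ by the mutually recursive grammar $X ::= I \mid AX \mid [\mathbf{X}]X$, $X^\ast ::= I \mid A^\ast X^\ast \mid [\mathbf{X}]^\ast X^\ast$, $\mathbf{X} ::= I \mid X^\ast\mathbf{X} \mid X\mathbf{X}$, where $A\in\mathcal{S}$, $I$ is the empty word, juxtaposition is concatenation, $[\,]$ are formal brackets and $(-)^\ast$ marks formal duals. $\mathcal{S}^\sharp$ is the set of covariant words. Duality on words: $(A)^\ast=A^\ast$, $(A^\ast)^\ast=A$, $I^\ast=I$, $(X\mathbf{Y})^\ast=\mathbf{Y}^\ast X^\ast$, $(\mathbf{Y}X)^\ast=X^\ast\mathbf{Y}^\ast$, $([\mathbf{X}])^\ast=[\mathbf{X}^\ast]^\ast$, $([\mathbf{X}]^\ast)^\ast=[\mathbf{X}^\ast]$. A closed monoidal signature $(\mathcal{S},\Sigma,ar,coar)$ consists of a set $\mathcal{S}$ of sorts, a set $\Sigma$ of generators and functions $ar,coar:\Sigma\to\mathcal{S}^\sharp$ (domain and codomain). Terms. Covariant terms are built from: the bracket generators (typed as indicated, for all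 words of the appropriate kinds) $\mathrm{bcup}:[I]\to I$; $\mathrm{bcap}:I\to[I]$; $\mathrm{din}_{X,\mathbf{Y}}:X[\mathbf{Y}]\to[X\mathbf{Y}]$; $\mathrm{dout}_{X,Y}:[XY]\to X[Y]$; $\mathrm{uin}_{X^\ast,Y^\ast,\mathbf{Z},W^\ast}:[X^\ast Y^\ast[\mathbf{Z}]W^\ast]\to[X^\ast[Y^\ast\mathbf{Z}]W^\ast]$; $\mathrm{uout}_{\mathbf{X},Y^\ast,\mathbf{Z},\mathbf{W}}:[\mathbf{X}[Y^\ast\mathbf{Z}]\mathbf{W}]\to[\mathbf{X}Y^\ast[\mathbf{Z}]\mathbf{W}]$; $\mathrm{xcup}_{X,\mathbf{Y}}:X[X^\ast\mathbf{Y}]\to[\mathbf{Y}]$; $\mathrm{rcap}_{\mathbf{X},Y,\mathbf{Z}}:[\mathbf{X}\mathbf{Z}]\to[\mathbf{X}Y^\ast Y\mathbf{Z}]$; $\mathrm{rcup}_{\mathbf{X},Y,\mathbf{Z}}:[\mathbf{X}Y][Y^\ast\mathbf{Z}]\to[\mathbf{X}\mathbf{Z}]$; and their mirror images $\mathrm{din}'_{\mathbf{Y},X}:[\mathbf{Y}]X\to[\mathbf{Y}X]$; $\mathrm{dout}'_{Y,X}:[YX]\to[Y]X$; $\mathrm{uin}'_{W^\ast,\mathbf{Z},Y^\ast,X^\ast}:[W^\ast[\mathbf{Z}]Y^\ast X^\ast]\to[W^\ast[\mathbf{Z}Y^\ast]X^\ast]$; $\mathrm{uout}'_{\mathbf{W},\mathbf{Z},Y^\ast,\mathbf{X}}:[\mathbf{W}[\mathbf{Z}Y^\ast]\mathbf{X}]\to[\mathbf{W}[\mathbf{Z}]Y^\ast\mathbf{X}]$;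 $\mathrm{xcup}'_{\mathbf{Y},X}:[\mathbf{Y}X^\ast]X\to[\mathbf{Y}]$; $\mathrm{rcap}'_{\mathbf{Z},Y,\mathbf{X}}:[\mathbf{Z}\mathbf{X}]\to[\mathbf{Z}YY^\ast\mathbf{X}]$; $\mathrm{rcup}'_{\mathbf{Z},Y,\mathbf{X}}:[\mathbf{Z}Y^\ast][Y\mathbf{X}]\to[\mathbf{Z}\mathbf{X}]$; together with identities $\mathrm{id}_X$, generators $f:ar(f)\to coar(f)$ for $f\in\Sigma$, composition $t_1;t_2:X\to Z$ for $t_1:X\to Y,t_2:Y\to Z$, tensor $t_1\otimes t_2:XZ\to YW$ for $t_1:X\to Y,t_2:Z\to W$, symmetries $\sigma_{X,Y}:XY\to YX$, and bracketing $[\mathbf{t}]:[\mathbf{X}]\to[\mathbf{Y}]$ for a mixed term $\mathbf{t}:\mathbf{X}\to\mathbf{Y}$. Contravariant terms are the formal duals: each term $t:X\to Y$ has a dual $t^\ast:Y^\ast\to X^\ast$, with $(t^\ast)^\ast=t$, $(\mathrm{id}_X)^\ast=\mathrm{id}_{X^\ast}$, $(t_1;t_2)^\ast=t_2^\ast;t_1^\ast$, $(t_1\otimes t_2)^\ast=t_2^\ast\otimes t_1^\ast$, $(\sigma_{X,Y})^\ast=\sigma_{Y^\ast,X^\ast}$, $([\mathbf{t}])^\ast=[\mathbf{t}^\ast]^\ast$. Mixed terms are covariant terms, contravariant terms, composites and tensors of mixed terms, and the symmetries $\sigma_{X,Y^\ast}:XY^\ast\to Y^\ast X$, $\sigma_{X^\ast,Y}:X^\ast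 Y\to YX^\ast$ (with $(\sigma_{X,Y^\ast})^\ast=\sigma_{Y,X^\ast}$, $(\sigma_{X^\ast,Y})^\ast=\sigma_{Y^\ast,X}$). Only well-typed terms are considered. Equations. Let $\cong$ be the smallest congruence on terms (closed under $;$, $\otimes$, $(-)^\ast$, $[-]$) containing: the axioms of symmetric monoidal categories (unit and associativity laws for $;$ and $\otimes$, interchange $(t_1\otimes t_2);(t_3\otimes t_4)=(t_1;t_3)\otimes(t_2;t_4)$, symmetries involutive and natural), for covariant, contravariant and mixed terms including the mixed symmetries ($\sigma_{X,Y^\ast};\sigma_{Y^\ast,X}=\mathrm{id}$, $\sigma_{X^\ast,Y};\sigma_{Y,X^\ast}=\mathrm{id}$, and naturality); crossing: $(\mathrm{id}_X\otimes[\sigma_{\mathbf{Y},X^\ast}]);\mathrm{xcup}_{X,\mathbf{Y}}=\sigma_{X,[\mathbf{Y}X^\ast]};\mathrm{xcup}'_{\mathbf{Y},X}$; $\mathrm{rcap}_{\mathbf{X},Y,\mathbf{Z}};[\mathrm{id}_{\mathbf{X}}\otimes\sigma_{Y^\ast,Y}\otimes\mathrm{id}_{\mathbf{Z}}]=\mathrm{rcap}'_{\mathbf{X},Y,\mathbf{Z}}$; $\mathrm{din}_{X,Y};\mathrm{dout}_{X,Y}=\mathrm{id}$, $\mathrm{dout}_{X,Y};\mathrm{din}_{X,Y}=\mathrm{id}$; $\mathrm{uin}_{X^\ast,Y^\ast,\mathbf{Z},W^\ast};\mathrm{uout}_{X^\ast,Y^\ast,\mathbf{Z},W^\ast}=\mathrm{id}$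 and $\mathrm{uout};\mathrm{uin}=\mathrm{id}$ (same indices); naturality: for $t_0:X\to Y$ and $\mathbf{t}_1:\mathbf{Z}\to\mathbf{W}$, $(t_0\otimes[\mathrm{id}_{Y^\ast}\otimes\mathbf{t}_1]);\mathrm{xcup}_{Y,\mathbf{W}}=(\mathrm{id}_X\otimes[t_0^\ast\otimes\mathrm{id}_{\mathbf{Z}}]);\mathrm{xcup}_{X,\mathbf{Z}};[\mathbf{t}_1]$ and $[\mathrm{id}_{\mathbf{U}}\otimes\mathbf{t}_1];\mathrm{rcap}_{\mathbf{U},Y,\mathbf{W}};[\mathrm{id}_{\mathbf{U}}\otimes t_0^\ast\otimes\mathrm{id}_{Y\mathbf{W}}]=\mathrm{rcap}_{\mathbf{U},X,\mathbf{Z}};[\mathrm{id}_{\mathbf{U}X^\ast}\otimes t_0\otimes\mathbf{t}_1]$; for $\mathbf{t}_0:\mathbf{Y}\to\mathbf{Z}$, $\mathbf{t}_1:\mathbf{U}\to\mathbf{V}$, $(\mathrm{xcup}_{X,\mathbf{Y}W}\otimes\mathrm{id}_{[W^\ast\mathbf{U}]});([\mathbf{t}_0\otimes\mathrm{id}_W]\otimes[\mathrm{id}_{W^\ast}\otimes\mathbf{t}_1]);\mathrm{rcup}_{\mathbf{Z},W,\mathbf{V}}=(\mathrm{id}_X\otimes\mathrm{rcup}_{X^\ast\mathbf{Y},W,\mathbf{U}});\mathrm{xcup}_{X,\mathbf{Y}\mathbf{U}};[\mathbf{t}_0\otimes\mathbf{t}_1]$; yanking: $(\mathrm{id}_X\otimes\mathrm{rcap}_{I,X,\mathbf{Y}});\mathrm{xcup}_{X,X\mathbf{Y}}=\mathrm{din}_{X,\mathbf{Y}}$;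 $\mathrm{rcap}_{\mathbf{X},Y,[Y^\ast\mathbf{Z}]\mathbf{W}};[\mathrm{id}_{\mathbf{X}Y^\ast}\otimes\mathrm{xcup}_{Y,\mathbf{Z}}\otimes\mathrm{id}_{\mathbf{W}}]=\mathrm{uout}_{\mathbf{X},Y^\ast,\mathbf{Z},\mathbf{W}}$; $(\mathrm{id}_{[X]}\otimes\mathrm{rcap}_{I,X,\mathbf{Z}});\mathrm{rcup}_{I,X,X\mathbf{Z}}=(\mathrm{dout}'_{I,X}\otimes\mathrm{id}_{[\mathbf{Z}]});(\mathrm{id}_{[I]}\otimes\mathrm{din}_{X,\mathbf{Z}});(\mathrm{bcup}\otimes\mathrm{id}_{[X\mathbf{Z}]})$; bubbles: $\mathrm{bcap};\mathrm{bcup}=\mathrm{id}_I$, $\mathrm{bcup};\mathrm{bcap}=\mathrm{id}_{[I]}$, $(\mathrm{bcap}\otimes\mathrm{id}_{[\mathbf{X}]});\mathrm{rcup}_{I,I,\mathbf{X}}=\mathrm{id}_{[\mathbf{X}]}$, $[\mathbf{t}_0];[\mathbf{t}_1]=[\mathbf{t}_0;\mathbf{t}_1]$, $[\mathrm{id}_{\mathbf{X}}]=\mathrm{id}_{[\mathbf{X}]}$. $\mathscr{C}_\Sigma$ is the category whose objects are the elements of $\mathcal{S}^\sharp$ and whose morphisms $X\to Y$ are well-typed covariant terms $X\to Y$ modulo $\cong$.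
   Formalization: The dual of the symmetry σ_{X,Y} is taken to be σ_{X*,Y*} (likewise for mixed symmetries), since the stated σ_{Y*,X*} does not have the type (YX)*→(XY)* required of a dual; the symmetric monoidal axioms are read as including id⊗id=id and the hexagon. *)

(* Defs.v *)
From Corelib Require Import RelationClasses.
From mathcomp Require Import all_boot.

Set Implicit Arguments.
Unset Strict Implicit.
Unset Printing Implicit Defensive.

(* Hom-sets are setoids: morphisms are taken modulo [heq]. Composition is in
   diagrammatic order. *)
Record cat_data := CatData {
  ob :> Type;
  hom : ob -> ob -> Type;
  heq : forall X Y, hom X Y -> hom X Y -> Prop;
  cid : forall X, hom X X;
  comp : forall X Y Z, hom X Y -> hom Y Z -> hom X Z
}.

Arguments hom {c}.
Arguments heq {c X Y}.
Arguments cid {c}.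
Arguments comp {c X Y Z}.

Declare Scope cat_scope.
Delimit Scope cat_scope with cat.
Local Open Scope cat_scope.
Notation "f ≈ g" := (heq f g) (at level 70, no associativity) : cat_scope.
Notation "f ;; g" := (comp f g) (at level 60, right associativity) : cat_scope.

Record is_category (C : cat_data) : Prop := IsCategory {
  heq_equiv : forall X Y : C, Equivalence (@heq C X Y);
  comp_heq : forall (X Y Z : C) (f f' : hom X Y) (g g' : hom Y Z),
    f ≈ f' -> g ≈ g' -> f ;; g ≈ f' ;; g';
  comp_idl : forall (X Y : C) (f : hom X Y), cid X ;; f ≈ f;
  comp_idr : forall (X Y : C) (f : hom X Y), f ;; cid Y ≈ f;
  compA : forall (W X Y Z : C) (f : hom W X) (g : hom X Y) (h : hom Y Z),
    f ;; (g ;; h) ≈ (f ;; g) ;; h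
}.

Record functor_data (C D : cat_data) := FunctorData {
  fob :> C -> D;
  fhom : forall X Y : C, hom X Y -> hom (fob X) (fob Y)
}.

Arguments fhom {C D} f {X Y}.

Record is_functor (C D : cat_data) (F : functor_data C D) : Prop := IsFunctor {
  fhom_heq : forall (X Y : C) (f g : hom X Y), f ≈ g -> fhom F f ≈ fhom F g;
  fhom_id : forall X : C, fhom F (cid X) ≈ cid (F X);
  fhom_comp : forall (X Y Z : C) (f : hom X Y) (g : hom Y Z),
    fhom F (f ;; g) ≈ fhom F f ;; fhom F g
}.

Record is_adjunction (C D : cat_data)
    (F : functor_data C D) (G : functor_data D C)
    (phi : forall X Y, hom (F X) Y -> hom X (G Y))
    (psi : forall X Y, hom X (G Y) -> hom (F X) Y) : Prop := IsAdjunction {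
  phi_heq : forall X Y (f f' : hom (F X) Y), f ≈ f' -> phi X Y f ≈ phi X Y f';
  psi_heq : forall X Y (g g' : hom X (G Y)), g ≈ g' -> psi X Y g ≈ psi X Y g';
  phiK : forall X Y (f : hom (F X) Y), psi X Y (phi X Y f) ≈ f;
  psiK : forall X Y (g : hom X (G Y)), phi X Y (psi X Y g) ≈ g;
  phi_natl : forall X X' Y (h : hom X' X) (f : hom (F X) Y),
    phi X' Y (fhom F h ;; f) ≈ h ;; phi X Y f;
  phi_natr : forall X Y Y' (f : hom (F X) Y) (k : hom Y Y'),
    phi X Y' (f ;; k) ≈ phi X Y f ;; fhom G k
}.

Definition has_right_adjoint (C D : cat_data) (F : functor_data C D) : Prop :=
  exists G phi psi, is_functor G /\ @is_adjunction C D F G phi psi.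

Record monoidal_data (C : cat_data) := MonoidalData {
  tob : C -> C -> C;
  thom : forall X X' Y Y' : C,
    hom X X' -> hom Y Y' -> hom (tob X Y) (tob X' Y');
  munit : C;
  assoc : forall X Y Z, hom (tob (tob X Y) Z) (tob X (tob Y Z));
  assocV : forall X Y Z, hom (tob X (tob Y Z)) (tob (tob X Y) Z);
  lunit : forall X, hom (tob munit X) X;
  lunitV : forall X, hom X (tob munit X);
  runit : forall X, hom (tob X munit) X;
  runitV : forall X, hom X (tob X munit);
  braid : forall X Y, hom (tob X Y) (tob Y X)
}.

Arguments thom {C} m {X X' Y Y'}.

Record is_symmetric_monoidal (C : cat_data) (M : monoidal_data C) : Prop :=
    IsSymmetricMonoidal {
  thom_heq : forall (X X' Y Y' : C) (f f' : hom X X') (g g' : hom Y Y'),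
    f ≈ f' -> g ≈ g' -> thom M f g ≈ thom M f' g';
  thom_id : forall X Y : C, thom M (cid X) (cid Y) ≈ cid (tob M X Y);
  thom_comp : forall (X X' X'' Y Y' Y'' : C) (f : hom X X') (f' : hom X' X'')
      (g : hom Y Y') (g' : hom Y' Y''),
    thom M (f ;; f') (g ;; g') ≈ thom M f g ;; thom M f' g';
  assocK : forall X Y Z, assoc M X Y Z ;; assocV M X Y Z ≈ cid _;
  assocVK : forall X Y Z, assocV M X Y Z ;; assoc M X Y Z ≈ cid _;
  assoc_nat : forall (X X' Y Y' Z Z' : C) (f : hom X X') (g : hom Y Y')
      (h : hom Z Z'),
    thom M (thom M f g) h ;; assoc M X' Y' Z' ≈
    assoc M X Y Z ;; thom M f (thom M g h);
  lunitK : forall X, lunit M X ;; lunitV M X ≈ cid _;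
  lunitVK : forall X, lunitV M X ;; lunit M X ≈ cid _;
  lunit_nat : forall (X X' : C) (f : hom X X'),
    thom M (cid (munit M)) f ;; lunit M X' ≈ lunit M X ;; f;
  runitK : forall X, runit M X ;; runitV M X ≈ cid _;
  runitVK : forall X, runitV M X ;; runit M X ≈ cid _;
  runit_nat : forall (X X' : C) (f : hom X X'),
    thom M f (cid (munit M)) ;; runit M X' ≈ runit M X ;; f;
  pentagon : forall W X Y Z : C,
    assoc M (tob M W X) Y Z ;; assoc M W X (tob M Y Z) ≈
    thom M (assoc M W X Y) (cid Z) ;; assoc M W (tob M X Y) Z ;;
      thom M (cid W) (assoc M X Y Z);
  triangle : forall X Y : C,
    assoc M X (munit M) Y ;; thom M (cid X) (lunit M Y) ≈
    thom M (runit M X) (cid Y);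
  braid_nat : forall (X X' Y Y' : C) (f : hom X X') (g : hom Y Y'),
    thom M f g ;; braid M X' Y' ≈ braid M X Y ;; thom M g f;
  braidK : forall X Y, braid M X Y ;; braid M Y X ≈ cid _;
  hexagon : forall X Y Z : C,
    assoc M X Y Z ;; braid M X (tob M Y Z) ;; assoc M Y Z X ≈
    thom M (braid M X Y) (cid Z) ;; assoc M Y X Z ;;
      thom M (cid Y) (braid M X Z)
}.

Definition tensor_left (C : cat_data) (M : monoidal_data C) (X : C) :
    functor_data C C :=
  @FunctorData C C (tob M X) (fun _ _ h => thom M (cid X) h).

Definition is_closed (C : cat_data) (M : monoidal_data C) : Prop :=
  forall X : C, has_right_adjoint (tensor_left M X).

(* A mixed word is a list of signed atoms: [(true, a)] is the atom [a] itself
   and [(false, a)] is the starred atom a^*, where [a] is a sort or a bracket.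
   Covariant words are those in which all signs are [true]; they are
   represented by their list of atoms. *)
Inductive atom (S : Type) : Type :=
| Srt of S
| Br of seq (bool * atom S).

Notation cword S := (seq (atom S)).
Notation mword S := (seq (bool * atom S)).

Definition pos (S : Type) (X : cword S) : mword S := [seq (true, a) | a <- X].

Definition br (S : Type) (w : mword S) : cword S := [:: Br w].

(* A starred bracket is marked by its sign. The dual of the bracket of w is the
   starred bracket of the dual of w, and conversely: duality flips the sign and
   dualizes the contents. *)
Fixpoint datom (S : Type) (a : atom S) : atom S :=
  match a with
  | Srt A => Srt A
  | Br w => Br (rev [seq (~~ p.1, datom p.2) | p <- w])
  end.

Definition wdual (S : Type) (w : mword S) : mword S :=
  rev [seq (~~ p.1, datom p.2) | p <- w].

(* The word X^*. Duality being an involution, the contravariant words are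
   exactly the words [neg X]; they are indexed by [X] below. *)
Definition neg (S : Type) (X : cword S) : mword S := wdual (pos X).

Record signature := Signature {
  sort : Type;
  gen : Type;
  ar : gen -> cword sort;
  coar : gen -> cword sort
}.

Inductive bgen (S : Type) : Type :=
| bcup
| bcap
| din (X : cword S) (Y : mword S)
| dout (X Y : cword S)
| uin (X Y : cword S) (Z : mword S) (W : cword S)
| uout (X : mword S) (Y : cword S) (Z W : mword S)
| xcup (X : cword S) (Y : mword S)
| rcap (X : mword S) (Y : cword S) (Z : mword S)
| rcup (X : mword S) (Y : cword S) (Z : mword S)
| din' (Y : mword S) (X : cword S)
| dout' (Y X : cword S)
| uin' (W : cword S) (Z : mword S) (Y X : cword S)
| uout' (W Z : mword S) (Y : cword S) (X : mword S)
| xcup' (Y : mword S) (X : cword S)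
| rcap' (Z : mword S) (Y : cword S) (X : mword S)
| rcup' (Z : mword S) (Y : cword S) (X : mword S).

Arguments bcup {S}.
Arguments bcap {S}.

Definition bdom (S : Type) (g : bgen S) : cword S :=
  match g with
  | bcup => br [::]
  | bcap => [::]
  | din X Y => X ++ br Y
  | dout X Y => br (pos X ++ pos Y)
  | uin X Y Z W => br (neg X ++ neg Y ++ pos (br Z) ++ neg W)
  | uout X Y Z W => br (X ++ pos (br (neg Y ++ Z)) ++ W)
  | xcup X Y => X ++ br (neg X ++ Y)
  | rcap X Y Z => br (X ++ Z)
  | rcup X Y Z => br (X ++ pos Y) ++ br (neg Y ++ Z)
  | din' Y X => br Y ++ X
  | dout' Y X => br (pos Y ++ pos X)
  | uin' W Z Y X => br (neg W ++ pos (br Z) ++ neg Y ++ neg X)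
  | uout' W Z Y X => br (W ++ pos (br (Z ++ neg Y)) ++ X)
  | xcup' Y X => br (Y ++ neg X) ++ X
  | rcap' Z Y X => br (Z ++ X)
  | rcup' Z Y X => br (Z ++ neg Y) ++ br (pos Y ++ X)
  end.

Definition bcod (S : Type) (g : bgen S) : cword S :=
  match g with
  | bcup => [::]
  | bcap => br [::]
  | din X Y => br (pos X ++ Y)
  | dout X Y => X ++ br (pos Y)
  | uin X Y Z W => br (neg X ++ pos (br (neg Y ++ Z)) ++ neg W)
  | uout X Y Z W => br (X ++ neg Y ++ pos (br Z) ++ W)
  | xcup X Y => br Y
  | rcap X Y Z => br (X ++ neg Y ++ pos Y ++ Z)
  | rcup X Y Z => br (X ++ Z)
  | din' Y X => br (Y ++ pos X)
  | dout' Y X => br (pos Y) ++ X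
  | uin' W Z Y X => br (neg W ++ pos (br (Z ++ neg Y)) ++ neg X)
  | uout' W Z Y X => br (W ++ pos (br Z) ++ neg Y ++ X)
  | xcup' Y X => br Y
  | rcap' Z Y X => br (Z ++ pos Y ++ neg Y ++ X)
  | rcup' Z Y X => br (Z ++ X)
  end.

(* Raw mixed terms; typing is the predicate [has_type] below. The sign of a
   generator tells whether it is the generator ([true]) or its formal dual
   ([false]); [Brk true t] is [t] and [Brk false t] is [t]^*. Identities and
   symmetries are available at all mixed words; the laws [ax_id_tens] and
   [ax_hexagon] reduce them to id_X, id_{X^*} and the four kinds of symmetries
   between covariant and contravariant words. *)
Inductive term (sg : signature) : Type :=
| Id (X : mword (sort sg))
| Sym (X Y : mword (sort sg))
| Gen (s : bool) (f : gen sg)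
| BGen (s : bool) (g : bgen (sort sg))
| Comp (t u : term sg)
| Tens (t u : term sg)
| Brk (s : bool) (t : term sg).

Arguments Id {sg}.
Arguments Sym {sg}.
Arguments Gen {sg}.
Arguments BGen {sg}.

(* The dual of the symmetry X Y -> Y X goes from (Y X)^* = X^* Y^* to
   (X Y)^* = Y^* X^*. *)
Fixpoint tdual (sg : signature) (t : term sg) : term sg :=
  match t with
  | Id X => Id (wdual X)
  | Sym X Y => Sym (wdual X) (wdual Y)
  | Gen s f => Gen (~~ s) f
  | BGen s g => BGen (~~ s) g
  | Comp t u => Comp (tdual u) (tdual t)
  | Tens t u => Tens (tdual u) (tdual t)
  | Brk s t => Brk (~~ s) (tdual t)
  end.

Fixpoint covariant (sg : signature) (t : term sg) : bool :=
  match t with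
  | Id X => all fst X
  | Sym X Y => all fst X && all fst Y
  | Gen s _ | BGen s _ | Brk s _ => s
  | Comp t u | Tens t u => covariant t && covariant u
  end.

Inductive has_type (sg : signature) :
    term sg -> mword (sort sg) -> mword (sort sg) -> Prop :=
| ty_id X : has_type (Id X) X X
| ty_sym X Y : has_type (Sym X Y) (X ++ Y) (Y ++ X)
| ty_gen f : has_type (Gen true f) (pos (ar f)) (pos (coar f))
| ty_gen_dual f : has_type (Gen false f) (neg (coar f)) (neg (ar f))
| ty_bgen g : has_type (BGen true g) (pos (bdom g)) (pos (bcod g))
| ty_bgen_dual g : has_type (BGen false g) (neg (bcod g)) (neg (bdom g))
| ty_comp t u X Y Z :
    has_type t X Y -> has_type u Y Z -> has_type (Comp t u) X Z
| ty_tens t u X Y Z W :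
    has_type t X Y -> has_type u Z W -> has_type (Tens t u) (X ++ Z) (Y ++ W)
| ty_brk s t X Y :
    has_type t X Y -> has_type (Brk s t) [:: (s, Br X)] [:: (s, Br Y)].

Declare Scope term_scope.
Delimit Scope term_scope with term.
Local Open Scope term_scope.
Notation "t ⊗ u" := (Tens t u) (at level 50, left associativity) : term_scope.
Notation "t ;; u" := (Comp t u) (at level 60, right associativity) : term_scope.
Notation "⟦ t ⟧" := (Brk true t) (at level 0, t at level 200) : term_scope.

Local Notation cId X := (Id (pos X)).
Local Notation nId X := (Id (neg X)).
Local Notation "! g" := (BGen true g) (at level 8, format "! g").

(* The equations; only the instances whose two sides are well typed are used
   (see [cong_ax]). Typing hypotheses appear where the words occurring in an
   equation are the domains or codomains of given terms. *)
Inductive axiom (sg : signature) : term sg -> term sg -> Prop :=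
| ax_comp_idl X t : axiom (Id X ;; t) t
| ax_comp_idr Y t : axiom (t ;; Id Y) t
| ax_compA t u v : axiom (t ;; (u ;; v)) ((t ;; u) ;; v)
| ax_tens_idl t : axiom (Id [::] ⊗ t) t
| ax_tens_idr t : axiom (t ⊗ Id [::]) t
| ax_tensA t u v : axiom (t ⊗ (u ⊗ v)) ((t ⊗ u) ⊗ v)
| ax_id_tens X Y : axiom (Id X ⊗ Id Y) (Id (X ++ Y))
| ax_interchange t1 t2 t3 t4 :
    axiom ((t1 ⊗ t2) ;; (t3 ⊗ t4)) ((t1 ;; t3) ⊗ (t2 ;; t4))
| ax_sym_invol X Y : axiom (Sym X Y ;; Sym Y X) (Id (X ++ Y))
| ax_sym_nat t u X Y Z W : has_type t X Y -> has_type u Z W ->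
    axiom ((t ⊗ u) ;; Sym Y W) (Sym X Z ;; (u ⊗ t))
| ax_hexagon X Y Z :
    axiom (Sym X (Y ++ Z)) ((Sym X Y ⊗ Id Z) ;; (Id Y ⊗ Sym X Z))
| ax_cross_xcup X Y :
    axiom ((cId X ⊗ ⟦Sym Y (neg X)⟧) ;; !(xcup X Y))
          (Sym (pos X) (pos (br (Y ++ neg X))) ;; !(xcup' Y X))
| ax_cross_rcap X Y Z :
    axiom (!(rcap X Y Z) ;; ⟦Id X ⊗ Sym (neg Y) (pos Y) ⊗ Id Z⟧)
          (!(rcap' X Y Z))
| ax_din_dout X Y :
    axiom (!(din X (pos Y)) ;; !(dout X Y)) (cId (X ++ br (pos Y)))
| ax_dout_din X Y :
    axiom (!(dout X Y) ;; !(din X (pos Y))) (cId (br (pos X ++ pos Y)))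
| ax_uin_uout X Y Z W :
    axiom (!(uin X Y Z W) ;; !(uout (neg X) Y Z (neg W)))
          (cId (br (neg X ++ neg Y ++ pos (br Z) ++ neg W)))
| ax_uout_uin X Y Z W :
    axiom (!(uout (neg X) Y Z (neg W)) ;; !(uin X Y Z W))
          (cId (br (neg X ++ pos (br (neg Y ++ Z)) ++ neg W)))
| ax_xcup_nat t0 X Y t1 Z W :
    covariant t0 -> has_type t0 (pos X) (pos Y) -> has_type t1 Z W ->
    axiom ((t0 ⊗ ⟦nId Y ⊗ t1⟧) ;; !(xcup Y W))
          ((cId X ⊗ ⟦tdual t0 ⊗ Id Z⟧) ;; !(xcup X Z) ;; ⟦t1⟧)
| ax_rcap_nat U t0 X Y t1 Z W :
    covariant t0 -> has_type t0 (pos X) (pos Y) -> has_type t1 Z W ->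
    axiom (⟦Id U ⊗ t1⟧ ;; !(rcap U Y W) ;; ⟦Id U ⊗ tdual t0 ⊗ Id (pos Y ++ W)⟧)
          (!(rcap U X Z) ;; ⟦Id (U ++ neg X) ⊗ t0 ⊗ t1⟧)
| ax_rcup_nat X W t0 Y Z t1 U V :
    has_type t0 Y Z -> has_type t1 U V ->
    axiom ((!(xcup X (Y ++ pos W)) ⊗ cId (br (neg W ++ U))) ;;
             (⟦t0 ⊗ cId W⟧ ⊗ ⟦nId W ⊗ t1⟧) ;; !(rcup Z W V))
          ((cId X ⊗ !(rcup (neg X ++ Y) W U)) ;;
             !(xcup X (Y ++ U)) ;; ⟦t0 ⊗ t1⟧)
| ax_yank_din X Y :
    axiom ((cId X ⊗ !(rcap [::] X Y)) ;; !(xcup X (pos X ++ Y))) (!(din X Y))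
| ax_yank_uout X Y Z W :
    axiom (!(rcap X Y (pos (br (neg Y ++ Z)) ++ W)) ;;
             ⟦Id (X ++ neg Y) ⊗ !(xcup Y Z) ⊗ Id W⟧)
          (!(uout X Y Z W))
| ax_yank_rcup X Z :
    axiom ((cId (br (pos X)) ⊗ !(rcap [::] X Z)) ;;
             !(rcup [::] X (pos X ++ Z)))
          ((!(dout' [::] X) ⊗ cId (br Z)) ;;
             (cId (br [::]) ⊗ !(din X Z)) ;; (!bcup ⊗ cId (br (pos X ++ Z))))
| ax_bcap_bcup : axiom (!bcap ;; !bcup) (Id [::])
| ax_bcup_bcap : axiom (!bcup ;; !bcap) (cId (br [::]))
| ax_bcap_rcup X :
    axiom ((!bcap ⊗ cId (br X)) ;; !(rcup [::] [::] X)) (cId (br X))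
| ax_brk_comp t0 t1 : axiom (⟦t0⟧ ;; ⟦t1⟧) ⟦t0 ;; t1⟧
| ax_brk_id X : axiom ⟦Id X⟧ (cId (br X)).

Inductive cong (sg : signature) : mword (sort sg) -> mword (sort sg) ->
    term sg -> term sg -> Prop :=
| cong_ax X Y t u :
    axiom t u -> has_type t X Y -> has_type u X Y -> cong X Y t u
| cong_refl X Y t : has_type t X Y -> cong X Y t t
| cong_sym X Y t u : cong X Y t u -> cong X Y u t
| cong_trans X Y t u v : cong X Y t u -> cong X Y u v -> cong X Y t v
| cong_comp X Y Z t t' u u' :
    cong X Y t t' -> cong Y Z u u' -> cong X Z (t ;; u) (t' ;; u')
| cong_tens X Y Z W t t' u u' :
    cong X Y t t' -> cong Z W u u' ->
    cong (X ++ Z) (Y ++ W) (t ⊗ u) (t' ⊗ u')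
| cong_dual X Y t u :
    cong X Y t u -> cong (wdual Y) (wdual X) (tdual t) (tdual u)
| cong_brk s X Y t u :
    cong X Y t u -> cong [:: (s, Br X)] [:: (s, Br Y)] (Brk s t) (Brk s u).

Record diag (sg : signature) (X Y : cword (sort sg)) := Diag {
  diag_term :> term sg;
  diag_cov : covariant diag_term;
  diag_type : has_type diag_term (pos X) (pos Y)
}.

Section DiagCategory.

Variable sg : signature.
Implicit Types X Y Z : cword (sort sg).

Definition diag_eq X Y (t u : diag X Y) : Prop := cong (pos X) (pos Y) t u.

Fact all_fst_pos X : all fst (pos X).
Proof. by elim: X. Qed.

(* The identity term id_X seen as a morphism between equal words; this gives
   the (strict) coherence isomorphisms. *)
Definition diag_cast X Y (e : X = Y) : diag X Y :=
  @Diag sg X Y (Id (pos X)) (all_fst_pos X)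
    (eq_ind X (fun W => has_type (Id (pos X)) (pos X) (pos W))
       (ty_id (pos X)) Y e).

Definition diag_id X : diag X X := diag_cast (erefl X).

Fact diag_comp_cov X Y Z (t : diag X Y) (u : diag Y Z) : covariant (t ;; u).
Proof. by rewrite /= !diag_cov. Qed.

Definition diag_comp X Y Z (t : diag X Y) (u : diag Y Z) : diag X Z :=
  Diag (diag_comp_cov t u) (ty_comp (diag_type t) (diag_type u)).

Fact diag_tens_cov X X' Y Y' (t : diag X X') (u : diag Y Y') :
  covariant (t ⊗ u).
Proof. by rewrite /= !diag_cov. Qed.

Fact diag_tens_type X X' Y Y' (t : diag X X') (u : diag Y Y') :
  has_type (t ⊗ u) (pos (X ++ Y)) (pos (X' ++ Y')).
Proof. by rewrite /pos !map_cat; exact: ty_tens (diag_type t) (diag_type u). Qed.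

Definition diag_tens X X' Y Y' (t : diag X X') (u : diag Y Y') :
    diag (X ++ Y) (X' ++ Y') :=
  Diag (diag_tens_cov t u) (diag_tens_type t u).

Fact diag_sym_cov X Y : covariant (@Sym sg (pos X) (pos Y)).
Proof. by rewrite /= !all_fst_pos. Qed.

Fact diag_sym_type X Y :
  has_type (@Sym sg (pos X) (pos Y)) (pos (X ++ Y)) (pos (Y ++ X)).
Proof. by rewrite /pos !map_cat; exact: ty_sym. Qed.

Definition diag_sym X Y : diag (X ++ Y) (Y ++ X) :=
  Diag (diag_sym_cov X Y) (diag_sym_type X Y).

Definition diag_cat : cat_data :=
  @CatData (cword (sort sg)) (@diag sg) diag_eq diag_id diag_comp.

Definition diag_monoidal : monoidal_data diag_cat :=
  @MonoidalData diag_cat (@cat _) diag_tens [::]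
    (fun X Y Z => diag_cast (esym (catA X Y Z)))
    (fun X Y Z => diag_cast (catA X Y Z))
    (fun X => diag_cast (cat0s X))
    (fun X => diag_cast (esym (cat0s X)))
    (fun X => diag_cast (cats0 X))
    (fun X => diag_cast (esym (cats0 X)))
    diag_sym.

End DiagCategory.

(* Main.v *)
(* The internal hom is X ⊸ Y := [X^* Y].  Currying a diagram f : X Y -> Z is
   Y ≅ [Y] -> [X^* X Y] -> [X^* Z] (a cap, then [f]), and uncurrying is a cup
   followed by [Z] ≅ Z.  By yanking, uncurrying a curried diagram precomposes
   it with an invertible composite of din's, while currying an uncurried
   diagram postcomposes it with an invertible composite built from uout.  Hence
   currying is bijective, and no coherence between the cups at X Y and those at
   X and Y is needed: the inverse absorbs the first of the two automorphisms. *)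
From Corelib Require Import Setoid Morphisms.
From mathcomp Require Import all_boot.
Require Import Defs.

Set Implicit Arguments.
Unset Strict Implicit.
Unset Printing Implicit Defensive.

Local Open Scope term_scope.

Local Notation cId X := (Id (pos X)).
Local Notation nId X := (Id (neg X)).
Local Notation "! g" := (BGen true g) (at level 8, format "! g").

(** * Duality of words is an involution *)

Section Words.

Variable S : Type.

Lemma pos_cat (X Y : cword S) : pos (X ++ Y) = pos X ++ pos Y.
Proof. exact: map_cat. Qed.

Lemma neg0 : neg [::] = [::] :> mword S.
Proof. by []. Qed.

Lemma wdual_cat (X Y : mword S) : wdual (X ++ Y) = wdual Y ++ wdual X.
Proof. by rewrite /wdual map_cat rev_cat. Qed.

(** Since [atom] is nested in lists, involutivity on the letters is assumed as a recursive
    conjunction, which the nested fixpoint in [datomK] can build. *)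
Lemma wdualK_of (w : mword S) :
  foldr (fun p P => datom (datom p.2) = p.2 /\ P) True w -> wdual (wdual w) = w.
Proof.
rewrite /wdual map_rev revK -map_comp.
by elim: w => //= -[s a] w IHw [/= -> /IHw ->]; rewrite negbK.
Qed.

Fixpoint datomK (a : atom S) : datom (datom a) = a.
Proof.
case: a => [A|w]; first reflexivity.
rewrite /=; congr Br; apply: wdualK_of.
(* The inner recursion on the list exposes each letter as a subterm of [Br w], which keeps the calls
   to [datomK] guarded. *)
exact: ((fix all_datomK (w : mword S) :
    foldr (fun p P => datom (datom p.2) = p.2 /\ P) True w :=
  match w with
  | [::] => I
  | p :: w' => conj (datomK p.2) (all_datomK w')
  end) w).
Qed.

Lemma wdualK (w : mword S) : wdual (wdual w) = w.
Proof.
by apply: wdualK_of; elim: w => //= p w IHw; split=> //; exact: datomK.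
Qed.

End Words.

(** * Uniqueness of types, and the congruence on raw terms *)

Section Typing.

Variable sg : signature.
Implicit Types (t u v : term sg) (X Y Z W : mword (sort sg)).

Lemma ty_conv t X Y X' Y' :
  has_type t X Y -> X = X' -> Y = Y' -> has_type t X' Y'.
Proof. by move=> ? <- <-. Qed.

Lemma ty_comp_conv t u X Y Y' Z :
  has_type t X Y -> has_type u Y' Z -> Y = Y' -> has_type (t ;; u) X Z.
Proof. by move=> tt uu e; rewrite -e in uu; apply: ty_comp tt uu. Qed.

Lemma ty_dual t X Y :
  has_type t X Y -> has_type (tdual t) (wdual Y) (wdual X).
Proof.
elim=> {t X Y} /=; try by move=> *; rewrite ?wdualK; constructor.
- by move=> X Y; rewrite !wdual_cat; constructor.
- by move=> t u X Y Z _ tt _ uu; apply: ty_comp uu tt.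
- by move=> t u X Y Z W _ tt _ uu; rewrite !wdual_cat; constructor.
Qed.

Lemma ty_comp_inv t u X Z :
  has_type (t ;; u) X Z -> exists2 Y, has_type t X Y & has_type u Y Z.
Proof. by move=> h; inversion h; subst; exists Y. Qed.

Lemma ty_tens_inv t u V V' : has_type (t ⊗ u) V V' ->
  exists X Y Z W, [/\ has_type t X Y, has_type u Z W, V = X ++ Z & V' = Y ++ W].
Proof. by move=> h; inversion h; subst; exists X, Y, Z, W. Qed.

Lemma ty_brk_inv s t V V' : has_type (Brk s t) V V' ->
  exists X Y, [/\ has_type t X Y, V = [:: (s, Br X)] & V' = [:: (s, Br Y)]].
Proof. by move=> h; inversion h; subst; exists X, Y. Qed.

(** Identities, symmetries and generators determine their own words, so types are synthesized from
    the leaves; a composite takes its source from [t] and its target from [u]. *)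
Lemma ty_inj t X Y X' Y' :
  has_type t X Y -> has_type t X' Y' -> X = X' /\ Y = Y'.
Proof.
move=> h; elim: h X' Y' => {t X Y}; try by move=> *; match goal with
  h : has_type _ _ _ |- _ => inversion h end.
- move=> t u X Y Z _ IHt _ IHu X' Z' /ty_comp_inv[Y' /IHt[-> _] /IHu[_ ->]].
  by [].
- move=> t u X Y Z W _ IHt _ IHu V V' /ty_tens_inv[? [? [? [? []]]]].
  by move=> /IHt[-> ->] /IHu[-> ->] -> ->.
- by move=> s t X Y _ IHt V V' /ty_brk_inv[? [? [/IHt[-> ->] -> ->]]].
Qed.

Lemma cong_typed X Y t u : cong X Y t u -> has_type t X Y /\ has_type u X Y.
Proof.
elim=> {X Y t u}; try by move=> *; split.
- by move=> X Y t u _ [].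
- by move=> X Y t u v _ [? _] _ [].
- by move=> X Y Z t t' u u' _ [? ?] _ [? ?]; split; apply: ty_comp; eassumption.
- by move=> X Y Z W t t' u u' _ [? ?] _ [? ?]; split; constructor.
- by move=> X Y t u _ [? ?]; split; apply: ty_dual.
- by move=> s X Y t u _ [? ?]; split; constructor.
Qed.

(* Since a term has at most one type, [cong] can be handled as an untyped
   congruence, which makes setoid rewriting available. *)
Record teq t u : Prop := Teq {
  cong_of_teq : forall X Y, has_type t X Y \/ has_type u X Y -> cong X Y t u
}.

(** One type suffices: [cong_typed] gives it to [u] as well, and [ty_inj] excludes any other. *)
Lemma teqP X Y t u : has_type t X Y -> teq t u <-> cong X Y t u.
Proof.
move=> tt; split=> [[]|c]; first by apply; left.
split=> X' Y' tu.
have [_ uu] := cong_typed c.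
by have [<- <-] : X = X' /\ Y = Y' by case: tu; apply: ty_inj.
Qed.

Lemma teq_axiom X Y t u :
  axiom t u -> has_type t X Y -> has_type u X Y -> teq t u.
Proof. by move=> ax tt uu; apply/(teqP _ tt); apply: cong_ax. Qed.

(** The disjunction in [teq] gives symmetry. For transitivity, a type of either outer term passes to
    the middle one by [cong_typed]. *)
#[global] Instance teq_equiv : Equivalence teq.
Proof.
split.
- by move=> t; split=> X Y [] ?; apply: cong_refl.
- by move=> t u [tu]; split=> X Y /or_comm/tu/cong_sym.
- move=> t u v [tu] [uv]; split=> X Y [tt|vv].
    have c := tu _ _ (or_introl tt); have [_ uu] := cong_typed c.
    exact: cong_trans c (uv _ _ (or_introl uu)).
  have c := uv _ _ (or_intror vv); have [uu _] := cong_typed c.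
  exact: cong_trans (tu _ _ (or_intror uu)) c.
Qed.

#[global] Instance teq_comp : Proper (teq ==> teq ==> teq) (@Comp sg).
Proof.
move=> t t' [tt'] u u' [uu']; split=> X Z [] /ty_comp_inv[Y ? ?];
by apply: (cong_comp (Y := Y)); [apply: tt' | apply: uu']; auto.
Qed.

#[global] Instance teq_tens : Proper (teq ==> teq ==> teq) (@Tens sg).
Proof.
move=> t t' [tt'] u u' [uu']; split=> V V' [];
move=> /ty_tens_inv[? [? [? [? [? ? -> ->]]]]];
by apply: cong_tens; [apply: tt' | apply: uu']; auto.
Qed.

#[global] Instance teq_brk s : Proper (teq ==> teq) (@Brk sg s).
Proof.
move=> t t' [tt']; split=> V V' [] /ty_brk_inv[? [? [? -> ->]]];
by apply: cong_brk; apply: tt'; auto.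
Qed.

End Typing.

Local Notation "t ≡ u" := (teq t u) (at level 70, no associativity).

#[local] Hint Extern 0 (teq _ _) => reflexivity : core.

(** * Type inference directed by the syntax of terms *)

Ltac word_eq :=
  rewrite /bdom /bcod /br ?pos_cat ?neg0 /= ?pos_cat /= -?catA /= ?cats0;
  reflexivity.

Ltac infer_type :=
  lazymatch goal with
  | |- has_type (Id _) _ _ => apply: ty_id
  | |- has_type (Sym _ _) _ _ => apply: ty_sym
  | |- has_type (BGen true _) _ _ => apply: ty_bgen
  | |- has_type (_ ;; _) _ _ =>
      eapply ty_comp_conv; [infer_type | infer_type | word_eq]
  | |- has_type (_ ⊗ _) _ _ => eapply ty_tens; infer_type
  | |- has_type (Brk _ _) _ _ => eapply ty_brk; infer_type
  | |- has_type (tdual _) _ _ => eapply ty_dual; infer_type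
  | |- has_type (diag_term _) _ _ => eapply diag_type
  | |- _ => eassumption
  end.

(** The type is read off the term first and compared with the expected words afterwards, because the
    two agree only up to the monoid laws of concatenation and the expansion of [pos]. *)
Ltac typecheck := eapply ty_conv; [infer_type | word_eq | word_eq].

Ltac by_axiom ax := eapply (teq_axiom ax); typecheck.

(** * Monoidal and bracket laws for [teq] *)

Section Equations.

Variable sg : signature.
Implicit Types (t u v : term sg) (X Y Z W : mword (sort sg)).

(** Inversion turns a type of either side into a type of the other, so the law holds for raw
    terms. *)
Lemma teq_compA t u v : (t ;; u) ;; v ≡ t ;; u ;; v.
Proof.
split=> X Y tu; apply: cong_sym; apply: cong_ax; first exact: ax_compA.
  case: tu => // /ty_comp_inv[Z /ty_comp_inv[W ? ?] ?].
  by do 2!(apply: ty_comp; eauto).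
case: tu => // /ty_comp_inv[Z ? /ty_comp_inv[W ? ?]].
by do 2!(apply: ty_comp; eauto).
Qed.

Lemma teq_idl t X Y : has_type t X Y -> Id X ;; t ≡ t.
Proof. move=> tt; by_axiom (ax_comp_idl X t). Qed.

Lemma teq_idr t X Y : has_type t X Y -> t ;; Id Y ≡ t.
Proof. move=> tt; by_axiom (ax_comp_idr Y t). Qed.

Lemma teq_id_tens X Y : @Id sg X ⊗ Id Y ≡ Id (X ++ Y).
Proof. by_axiom (ax_id_tens X Y). Qed.

Lemma teq_tensA t u v : (t ⊗ u) ⊗ v ≡ t ⊗ (u ⊗ v).
Proof.
split=> X Y tu; apply: cong_sym; apply: cong_ax; first exact: ax_tensA.
  case: tu => // /ty_tens_inv[? [? [? [? [tu tv -> ->]]]]].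
  by have [? [? [? [? [? ? -> ->]]]]] := ty_tens_inv tu; typecheck.
case: tu => // /ty_tens_inv[? [? [? [? [tt uv -> ->]]]]].
by have [? [? [? [? [? ? -> ->]]]]] := ty_tens_inv uv; typecheck.
Qed.

Lemma teq_tens0t t : Id [::] ⊗ t ≡ t.
Proof.
split=> X Y tu.
have {tu} tt : has_type t X Y.
  by case: tu => // /ty_tens_inv[? [? [? [? [h ? -> ->]]]]]; inversion h.
by apply: cong_ax; [exact: ax_tens_idl | typecheck..].
Qed.

Lemma teq_tenst0 t : t ⊗ Id [::] ≡ t.
Proof.
split=> X Y tu.
have {tu} tt : has_type t X Y.
  case: tu => // /ty_tens_inv[? [? [? [? [? h -> ->]]]]].
  by inversion h; rewrite !cats0.
by apply: cong_ax; [exact: ax_tens_idr | typecheck..].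
Qed.

Lemma teq_brk_comp t u : ⟦t⟧ ;; ⟦u⟧ ≡ ⟦t ;; u⟧.
Proof.
split=> X Y tu; apply: cong_ax; first exact: ax_brk_comp.
  case: tu => // /ty_brk_inv[? [? [/ty_comp_inv[? ? ?] -> ->]]]; typecheck.
case: tu => // /ty_comp_inv[? /ty_brk_inv[? [? [? -> ->]]]].
(* The middle word is a single bracket on both sides; injectivity identifies its contents, so [t]
   and [u] compose. *)
by move=> /ty_brk_inv[? [? [? [e] ->]]]; subst; typecheck.
Qed.

Lemma teq_brk_id X : @Brk sg true (Id X) ≡ cId (br X).
Proof. by_axiom (ax_brk_id X). Qed.

Lemma teq_tens_comp t t' u u' X Y Z X' Y' Z' :
  has_type t X Y -> has_type t' Y Z -> has_type u X' Y' -> has_type u' Y' Z' ->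
  (t ⊗ u) ;; (t' ⊗ u') ≡ (t ;; t') ⊗ (u ;; u').
Proof.
move=> *; by_axiom (ax_interchange t u t' u').
Qed.

Lemma teq_tens_compl A t u X Y Z : has_type t X Y -> has_type u Y Z ->
  Id A ⊗ (t ;; u) ≡ (Id A ⊗ t) ;; (Id A ⊗ u).
Proof.
move=> tt uu; rewrite (teq_tens_comp (ty_id A) (ty_id A) tt uu).
by rewrite (teq_idl (ty_id A)).
Qed.

Lemma teq_brk_compl A t u X Y Z : has_type t X Y -> has_type u Y Z ->
  ⟦Id A ⊗ (t ;; u)⟧ ≡ ⟦Id A ⊗ t⟧ ;; ⟦Id A ⊗ u⟧.
Proof. by move=> tt uu; rewrite teq_brk_comp (teq_tens_compl A tt uu). Qed.

Lemma teq_tens_lr t u X Y Z W : has_type t X Y -> has_type u Z W ->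
  (t ⊗ Id Z) ;; (Id Y ⊗ u) ≡ t ⊗ u.
Proof.
move=> tt uu; rewrite (teq_tens_comp tt (ty_id _) (ty_id _) uu).
by rewrite (teq_idl uu) (teq_idr tt).
Qed.

Lemma teq_tens_rl t u X Y Z W : has_type t X Y -> has_type u Z W ->
  (Id X ⊗ u) ;; (t ⊗ Id W) ≡ t ⊗ u.
Proof.
move=> tt uu; rewrite (teq_tens_comp (ty_id _) tt uu (ty_id _)).
by rewrite (teq_idl tt) (teq_idr uu).
Qed.

End Equations.

(** * Naturality and yanking of cups and caps *)

Section InternalHom.

Variable sg : signature.
Implicit Types (f g t : term sg) (X Y Z W : cword (sort sg)).

Lemma xcup_nat f X Y t (Z W : mword (sort sg)) :
  covariant f -> has_type f (pos X) (pos Y) -> has_type t Z W ->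
  (f ⊗ ⟦nId Y ⊗ t⟧) ;; !(xcup Y W) ≡
  (cId X ⊗ ⟦tdual f ⊗ Id Z⟧) ;; !(xcup X Z) ;; ⟦t⟧.
Proof. move=> cf tf tt; by_axiom (ax_xcup_nat cf tf tt). Qed.

Lemma rcap_nat f X Y t (Z W : mword (sort sg)) :
  covariant f -> has_type f (pos X) (pos Y) -> has_type t Z W ->
  ⟦t⟧ ;; !(rcap [::] Y W) ;; ⟦tdual f ⊗ Id (pos Y ++ W)⟧ ≡
  !(rcap [::] X Z) ;; ⟦nId X ⊗ (f ⊗ t)⟧.
Proof.
move=> cf tf tt; rewrite -teq_tensA.
(* The identity of the empty word stands for [Id U] in the axiom, taken at [U] empty. *)
rewrite -[t in X in X ≡ _]teq_tens0t -[tdual f]teq_tens0t.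
by_axiom (ax_rcap_nat [::] cf tf tt).
Qed.

(** This is [xcup_nat] with an identity sliding around the cup; only the spectator term [t]
    moves. *)
Lemma xcup_natr t X (Z W : mword (sort sg)) : has_type t Z W ->
  (cId X ⊗ ⟦nId X ⊗ t⟧) ;; !(xcup X W) ≡ !(xcup X Z) ;; ⟦t⟧.
Proof.
move=> tt; rewrite (xcup_nat (all_fst_pos X : covariant (Id _)) (ty_id _) tt) /=.
rewrite teq_id_tens teq_brk_id teq_id_tens -teq_compA -pos_cat.
by rewrite (teq_idl (ty_bgen (xcup X Z))).
Qed.

Lemma rcap_natr t X (Z W : mword (sort sg)) : has_type t Z W ->
  !(rcap [::] X Z) ;; ⟦nId X ⊗ (cId X ⊗ t)⟧ ≡ ⟦t⟧ ;; !(rcap [::] X W).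
Proof.
move=> tt; rewrite -(rcap_nat (all_fst_pos X : covariant (Id _)) (ty_id _) tt) /=.
rewrite teq_id_tens teq_brk_id.
by rewrite (teq_idr (ty_bgen (rcap [::] X W))).
Qed.

Lemma yank_din X (Y : mword (sort sg)) :
  (cId X ⊗ !(rcap [::] X Y)) ;; !(xcup X (pos X ++ Y)) ≡
  @BGen sg true (din X Y).
Proof. by_axiom (ax_yank_din X Y). Qed.

Lemma yank_uout X (Z : mword (sort sg)) :
  !(rcap [::] X (pos (br (neg X ++ Z)))) ;; ⟦nId X ⊗ !(xcup X Z)⟧ ≡
  @BGen sg true (uout [::] X Z [::]).
Proof.
rewrite -[nId X ⊗ _]teq_tenst0 -{1}[pos (br _)]cats0.
by_axiom (ax_yank_uout [::] X Z [::]).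
Qed.

(** By yanking, [din] is a cap followed by a cup. The term [f] moves in front of the cup, slides
    around the cap to become [tdual f], then around the cup to come out as [f] on the outer word. *)
Lemma din_nat0 f X Y : covariant f -> has_type f (pos X) (pos Y) ->
  !(din X [::]) ;; ⟦f⟧ ≡ (f ⊗ cId (br [::])) ;; !(din Y [::]).
Proof.
move=> cf tf.
rewrite -!(yank_din _ [::]) !cats0 !teq_compA -(xcup_natr _ tf).
rewrite -teq_compA -(teq_tens_compl _ (X := pos (br [::]))
  (Y := pos (br (neg X ++ pos X))) (Z := pos (br (neg X ++ pos Y))));
  try typecheck.
have cap : !(rcap [::] X [::]) ;; ⟦nId X ⊗ f⟧ ≡
    !(rcap [::] Y [::]) ;; ⟦tdual f ⊗ cId Y⟧.
  rewrite -[f in X in X ≡ _]teq_tenst0 -(rcap_nat cf tf (ty_id _)) teq_brk_id.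
  by rewrite -teq_compA (teq_idl (ty_bgen (rcap [::] Y [::]))) cats0.
have cup : (f ⊗ cId (br (neg Y ++ pos Y))) ;; !(xcup Y (pos Y)) ≡
    (cId X ⊗ ⟦tdual f ⊗ cId Y⟧) ;; !(xcup X (pos Y)).
  rewrite -teq_brk_id -teq_id_tens (xcup_nat cf tf (ty_id _)) teq_brk_id.
  by rewrite (teq_idr (ty_bgen (xcup X (pos Y)))).
rewrite cap (teq_tens_compl _ (X := pos (br [::]))
  (Y := pos (br (neg Y ++ pos Y))) (Z := pos (br (neg X ++ pos Y))));
  try typecheck.
have tcap : has_type (@BGen sg true (rcap [::] Y [::]))
  (pos (br [::])) (pos (br (neg Y ++ pos Y))) by typecheck.
rewrite teq_compA -cup -!teq_compA.
by rewrite (teq_tens_lr tf tcap) (teq_tens_rl tf tcap).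
Qed.

(** * The natural isomorphism between X and [X] *)

Definition enter_term X : term sg := (cId X ⊗ !bcap) ;; !(din X [::]).
Definition leave_term X : term sg := !(dout X [::]) ;; (cId X ⊗ !bcup).

Fact enter_cov X : covariant (enter_term X).
Proof. by rewrite /= all_fst_pos. Qed.

Fact enter_type X : has_type (enter_term X) (pos X) (pos (br (pos X))).
Proof. by rewrite /enter_term; typecheck. Qed.

Fact leave_cov X : covariant (leave_term X).
Proof. by rewrite /= all_fst_pos. Qed.

Fact leave_type X : has_type (leave_term X) (pos (br (pos X))) (pos X).
Proof. by rewrite /leave_term; typecheck. Qed.

(** Locking keeps [/=] from unfolding the isomorphism, so that later rewriting treats it as an
    atomic diagram. *)
Definition enter X : diag X (br (pos X)) :=
  locked (Diag (enter_cov X) (enter_type X)).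

Definition leave X : diag (br (pos X)) X :=
  locked (Diag (leave_cov X) (leave_type X)).

(** The inner [din] and [dout] cancel, and a bubble equation removes the remaining empty bracket. *)
Lemma enterK X : enter X ;; leave X ≡ cId X.
Proof.
rewrite /enter /leave -!lock /= /enter_term /leave_term.
rewrite !teq_compA -[!(din _ _) ;; _]teq_compA.
have -> : !(din X [::]) ;; !(dout X [::]) ≡ @Id sg (pos X ++ pos (br [::])).
  rewrite -pos_cat; by_axiom (ax_din_dout X [::]).
have tcap : has_type (@BGen sg true bcap) [::] (pos (br [::])) by typecheck.
have tcup : has_type (@BGen sg true bcup) (pos (br [::])) [::] by typecheck.
rewrite (teq_idl (ty_tens (ty_id (pos X)) tcup)) -(teq_tens_compl _ tcap tcup).
have -> : !bcap ;; !bcup ≡ @Id sg [::] by by_axiom (ax_bcap_bcup sg).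
by rewrite teq_tenst0.
Qed.

Lemma leaveK X : leave X ;; enter X ≡ cId (br (pos X)).
Proof.
rewrite /enter /leave -!lock /= /enter_term /leave_term.
rewrite !teq_compA -[(_ ⊗ _) ;; (_ ;; _)]teq_compA.
have tcap : has_type (@BGen sg true bcap) [::] (pos (br [::])) by typecheck.
have tcup : has_type (@BGen sg true bcup) (pos (br [::])) [::] by typecheck.
rewrite -(teq_tens_compl _ tcup tcap).
have -> : !bcup ;; !bcap ≡ @Id sg (pos (br [::])) by by_axiom (ax_bcup_bcap sg).
rewrite teq_id_tens -pos_cat (teq_idl (ty_bgen (din X [::]))).
rewrite -(cats0 (pos X)); by_axiom (ax_dout_din X [::]).
Qed.

Lemma enter_nat X Y (f : diag X Y) : enter X ;; ⟦f⟧ ≡ f ;; enter Y.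
Proof.
rewrite /enter -!lock /= /enter_term.
rewrite teq_compA (din_nat0 (diag_cov f) (diag_type f)).
have tcap : has_type (@BGen sg true bcap) [::] (pos (br [::])) by typecheck.
rewrite -!teq_compA (teq_tens_rl (diag_type f) tcap).
by rewrite -(teq_tens_lr (diag_type f) tcap) teq_tenst0.
Qed.

(** Inverses of natural isomorphisms are natural: [leave X ;; enter X] is inserted in front and
    [enter_nat] applied. *)
Lemma leave_nat X Y (f : diag X Y) : ⟦f⟧ ;; leave Y ≡ leave X ;; f.
Proof.
have e : cId (br (pos X)) ;; ⟦f⟧ ≡ ⟦f⟧.
  exact: teq_idl (ty_brk true (diag_type f)).
rewrite -e -leaveK !teq_compA -(teq_compA (enter X)) enter_nat teq_compA enterK.
by rewrite (teq_idr (diag_type f)).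
Qed.

(** * Currying, uncurrying and their residual isomorphisms *)

Definition curry_term X Y (f : term sg) : term sg :=
  enter Y ;; !(rcap [::] X (pos Y)) ;; ⟦nId X ⊗ f⟧.

Definition uncurry_term X Z (g : term sg) : term sg :=
  (cId X ⊗ g) ;; !(xcup X (pos Z)) ;; leave Z.

#[local] Instance curry_teq X Y : Proper (@teq sg ==> @teq sg) (curry_term X Y).
Proof. by move=> f f' ff'; rewrite /curry_term ff'. Qed.

#[local] Instance uncurry_teq X Z :
  Proper (@teq sg ==> @teq sg) (uncurry_term X Z).
Proof. by move=> g g' gg'; rewrite /uncurry_term gg'. Qed.

(** The endomorphism of [X ++ Y] left over when a curried diagram is uncurried; [emit] consists of
    the inverse factors in reverse order. *)
Definition absorb X Y : term sg :=
  (cId X ⊗ enter Y) ;; !(din X (pos Y)) ;; leave (X ++ Y).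

Definition emit X Y : term sg :=
  enter (X ++ Y) ;; !(dout X Y) ;; (cId X ⊗ leave Y).

(** The corresponding residue on the internal hom [X^* Z], left over when an uncurried diagram is
    curried; [insert] reverses it. *)
Definition extract X Z : term sg :=
  enter (br (neg X ++ pos Z)) ;; !(uout [::] X (pos Z) [::]) ;;
  ⟦nId X ⊗ leave Z⟧.

Definition insert X Z : term sg :=
  ⟦nId X ⊗ enter Z⟧ ;; !(uin [::] X (pos Z) [::]) ;;
  leave (br (neg X ++ pos Z)).

(** The factors cancel from the middle outwards: [leave] with [enter] on [Y], [dout] with [din],
    [enter] with [leave] on [X ++ Y]. *)
Lemma emitK X Y : emit X Y ;; absorb X Y ≡ cId (X ++ Y).
Proof.
rewrite /emit /absorb !teq_compA -[(_ ⊗ leave Y) ;; _]teq_compA.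
rewrite -(teq_tens_compl _ (diag_type _) (diag_type _)) leaveK.
rewrite teq_id_tens -pos_cat -(teq_compA (Id _)).
rewrite (teq_idl (ty_bgen (din X (pos Y)))).
have e : !(dout X Y) ;; !(din X (pos Y)) ≡ @Id sg (pos (br (pos (X ++ Y)))).
  rewrite pos_cat; by_axiom (ax_dout_din X Y).
by rewrite -(teq_compA !(dout _ _)) e (teq_idl (diag_type (leave _))) enterK.
Qed.

Lemma insertK X Z : insert X Z ;; extract X Z ≡ cId (br (neg X ++ pos Z)).
Proof.
rewrite /insert /extract !teq_compA -(teq_compA (leave _)) leaveK.
rewrite -(teq_compA (Id _)).
rewrite (teq_idl (ty_bgen (uout [::] X (pos Z) [::]))).
rewrite -(teq_compA !(uin _ _ _ _)).
have -> : !(uin [::] X (pos Z) [::]) ;; !(uout [::] X (pos Z) [::]) ≡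
    @Id sg (pos (br (neg X ++ pos (br (pos Z))))).
  rewrite -[pos (br (pos Z))]cats0; by_axiom (ax_uin_uout [::] X (pos Z) [::]).
rewrite (teq_idl (ty_brk true (ty_tens (ty_id (neg X)) (diag_type (leave Z))))).
rewrite -(teq_brk_compl _ (diag_type _) (diag_type _)) enterK.
by rewrite teq_id_tens teq_brk_id.
Qed.

(** The bracketed [f] slides past the cup, the cap and cup that now meet yank to [din], and
    [leave_nat] frees [f] from its bracket. *)
Lemma curryK X Y Z (f : diag (X ++ Y) Z) :
  uncurry_term X Z (curry_term X Y f) ≡ absorb X Y ;; f.
Proof.
have tf : has_type f (pos X ++ pos Y) (pos Z).
  by rewrite -pos_cat; exact: diag_type.
rewrite /uncurry_term /curry_term -teq_compA.
have tcap : has_type (@BGen sg true (rcap [::] X (pos Y))) (pos (br (pos Y)))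
  (pos (br (neg X ++ pos X ++ pos Y))) by typecheck.
have tbrk := ty_brk true (ty_tens (ty_id (neg X)) tf).
rewrite (teq_tens_compl _ (diag_type _) (ty_comp tcap tbrk)).
rewrite (teq_tens_compl _ tcap tbrk) !teq_compA.
rewrite -(teq_compA (cId X ⊗ ⟦_⟧)) (xcup_natr X tf).
rewrite -!(teq_compA (cId X ⊗ !(rcap _ _ _))) yank_din.
by rewrite /absorb !teq_compA leave_nat.
Qed.

(** Here [g] slides back through the cap, the cap and the bracketed cup yank to [uout], and
    [enter_nat] frees [g] from its bracket. *)
Lemma uncurryK X Y Z (g : diag Y (br (neg X ++ pos Z))) :
  curry_term X Y (uncurry_term X Z g) ≡ g ;; extract X Z.
Proof.
rewrite /uncurry_term /curry_term.
have tcup : has_type (@BGen sg true (xcup X (pos Z)))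
  (pos X ++ pos (br (neg X ++ pos Z))) (pos (br (pos Z))) by typecheck.
have tg := ty_tens (ty_id (pos X)) (diag_type g).
rewrite (teq_brk_compl _ tg (ty_comp tcup (diag_type _))).
rewrite (teq_brk_compl _ tcup (diag_type _)).
rewrite -!(teq_compA !(rcap _ _ _)) (rcap_natr X (diag_type g)).
rewrite !teq_compA -(teq_compA !(rcap _ _ _)) yank_uout.
by rewrite -(teq_compA (enter Y)) enter_nat /extract !teq_compA.
Qed.

Fact curry_cov X Y Z (f : diag (X ++ Y) Z) : covariant (curry_term X Y f).
Proof. by rewrite /= diag_cov. Qed.

Fact curry_type X Y Z (f : diag (X ++ Y) Z) :
  has_type (curry_term X Y f) (pos Y) (pos (br (neg X ++ pos Z))).
Proof. by rewrite /curry_term; typecheck. Qed.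

Definition curry X Y Z (f : diag (X ++ Y) Z) : diag Y (br (neg X ++ pos Z)) :=
  Diag (curry_cov f) (curry_type f).

Fact uncurry_cov X Y Z (g : diag Y (br (neg X ++ pos Z))) :
  covariant (emit X Y ;; uncurry_term X Z g).
Proof. by rewrite /= !all_fst_pos !diag_cov. Qed.

Fact uncurry_type X Y Z (g : diag Y (br (neg X ++ pos Z))) :
  has_type (emit X Y ;; uncurry_term X Z g) (pos (X ++ Y)) (pos Z).
Proof. by rewrite /emit /uncurry_term; typecheck. Qed.

(** The leading [emit] cancels the [absorb] produced by [curryK]. *)
Definition uncurry X Y Z (g : diag Y (br (neg X ++ pos Z))) : diag (X ++ Y) Z :=
  Diag (uncurry_cov g) (uncurry_type g).

Fact insert_cov X Z : covariant (insert X Z).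
Proof. by rewrite /= diag_cov. Qed.

Fact insert_type X Z : has_type (insert X Z)
  (pos (br (neg X ++ pos Z))) (pos (br (neg X ++ pos Z))).
Proof. by rewrite /insert; typecheck. Qed.

Lemma uncurry_curry X Y Z (f : diag (X ++ Y) Z) : uncurry (curry f) ≡ f.
Proof. by rewrite /= curryK -teq_compA emitK (teq_idl (diag_type f)). Qed.

(** Currying is surjective: composing [g] with [insert] beforehand compensates the [extract] of
    [uncurryK]. A surjective map with a left inverse is bijective. *)
Lemma curry_uncurry X Y Z (g : diag Y (br (neg X ++ pos Z))) :
  curry (uncurry g) ≡ g.
Proof.
pose h := diag_comp g (Diag (insert_cov X Z) (insert_type X Z)).
have gE : g ≡ curry_term X Y (uncurry_term X Z h).
  by rewrite uncurryK /= teq_compA insertK (teq_idr (diag_type g)).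
have tf : has_type (uncurry_term X Z h) (pos (X ++ Y)) (pos Z).
  by rewrite /uncurry_term; typecheck.
have cf : covariant (uncurry_term X Z h).
  by rewrite /= !all_fst_pos !diag_cov.
(* The preimage of [g] under currying is [uncurry_term X Z h], to which the other round trip
   applies. *)
have e := curryK (Diag cf tf); rewrite /= in e.
by rewrite /= gE e -teq_compA emitK (teq_idl tf).
Qed.

(** The diagram [h] slides back through the cap by [rcap_natr], then leaves its bracket by
    [enter_nat]. *)
Lemma curry_natl X Y Y' Z (h : diag Y' Y) (f : diag (X ++ Y) Z) :
  curry (diag_comp (diag_tens (diag_id X) h) f) ≡ h ;; curry f.
Proof.
have tf : has_type f (pos X ++ pos Y) (pos Z).
  by rewrite -pos_cat; exact: diag_type.
have th := ty_tens (ty_id (pos X)) (diag_type h).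
rewrite /= /curry_term (teq_brk_compl _ th tf).
rewrite -(teq_compA !(rcap _ _ _)) (rcap_natr X (diag_type h)).
by rewrite !teq_compA -(teq_compA (enter _)) enter_nat !teq_compA.
Qed.

Lemma curry_natr X Y Z Z' (f : diag (X ++ Y) Z) (k : diag Z Z') :
  curry (diag_comp f k) ≡ curry f ;; ⟦nId X ⊗ k⟧.
Proof.
rewrite /= /curry_term !teq_compA.
by rewrite (teq_brk_compl _ (diag_type f) (diag_type k)).
Qed.

(** * The internal hom functor and the structure on [diag_cat] *)

Fact hom_type X Y Z (k : diag Y Z) :
  has_type ⟦nId X ⊗ k⟧ (pos (br (neg X ++ pos Y))) (pos (br (neg X ++ pos Z))).
Proof. by typecheck. Qed.

Definition hom_right X : functor_data (diag_cat sg) (diag_cat sg) :=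
  @FunctorData (diag_cat sg) (diag_cat sg) (fun Y => br (neg X ++ pos Y))
    (fun Y Z k => Diag (isT : covariant ⟦nId X ⊗ k⟧) (hom_type X k)).

Lemma diag_eqE X Y (f g : diag X Y) : diag_eq f g <-> f ≡ g.
Proof. by rewrite (teqP _ (diag_type f)). Qed.

Lemma diag_is_category : is_category (diag_cat sg).
Proof.
split=> /=.
- move=> X Y; split=> [f|f g|f g h]; rewrite !diag_eqE //.
    by move->.
  by move=> -> ->.
- by move=> X Y Z f f' g g'; rewrite !diag_eqE /= => -> ->.
- by move=> X Y f; rewrite !diag_eqE /= (teq_idl (diag_type f)).
- by move=> X Y f; rewrite !diag_eqE /= (teq_idr (diag_type f)).
- by move=> W X Y Z f g h; rewrite !diag_eqE /= teq_compA.
Qed.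

Lemma diag_is_closed : is_closed (diag_monoidal sg).
Proof.
move=> X; exists (hom_right X), (@curry X), (@uncurry X); split.
  split=> /=.
  - by move=> Y Z f g; rewrite !diag_eqE /= => ->.
  - by move=> Y; rewrite !diag_eqE /= teq_id_tens teq_brk_id.
  - move=> Y Z W f g; rewrite !diag_eqE /=.
    by rewrite (teq_brk_compl _ (diag_type f) (diag_type g)).
split=> /=.
- by move=> Y Z f f'; rewrite !diag_eqE /= => ->.
- by move=> Y Z g g'; rewrite !diag_eqE /= => ->.
- by move=> Y Z f; rewrite !diag_eqE; exact: uncurry_curry.
- by move=> Y Z g; rewrite !diag_eqE; exact: curry_uncurry.
- by move=> Y Y' Z h f; rewrite !diag_eqE; exact: curry_natl.
- by move=> Y Z Z' f k; rewrite !diag_eqE; exact: curry_natr.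
Qed.

(** Every associator and unitor has an identity as underlying term, so once words are normalized the
    coherence laws compare identities; the braiding laws reduce to the axioms on [Sym]. *)
Lemma diag_is_symmetric_monoidal : is_symmetric_monoidal (diag_monoidal sg).
Proof.
have id_id (w : mword (sort sg)) : @Id sg w ;; Id w ≡ Id w.
  exact: teq_idl (ty_id w).
split=> /=.
- by move=> X X' Y Y' f f' g g'; rewrite !diag_eqE /= => -> ->.
- by move=> X Y; rewrite !diag_eqE /= teq_id_tens pos_cat.
- move=> X X' X'' Y Y' Y'' f f' g g'; rewrite !diag_eqE /=.
  by rewrite (teq_tens_comp (diag_type f) (diag_type f') (diag_type g)
    (diag_type g')).
- by move=> X Y Z; rewrite !diag_eqE /= -catA id_id.
- by move=> X Y Z; rewrite !diag_eqE /= -catA id_id.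
- move=> X X' Y Y' Z Z' f g h; rewrite !diag_eqE /=.
  have tfgh : has_type (f ⊗ (g ⊗ h)) (pos (X ++ Y ++ Z)) (pos (X' ++ Y' ++ Z')).
    by typecheck.
  by rewrite teq_tensA -!catA (teq_idr tfgh) (teq_idl tfgh).
- by move=> X; rewrite !diag_eqE /= id_id.
- by move=> X; rewrite !diag_eqE /= id_id.
- move=> X X' f; rewrite !diag_eqE /= teq_tens0t.
  by rewrite (teq_idr (diag_type f)) (teq_idl (diag_type f)).
- by move=> X; rewrite !diag_eqE /= cats0 id_id.
- by move=> X; rewrite !diag_eqE /= cats0 id_id.
- move=> X X' f; rewrite !diag_eqE /= teq_tenst0 !cats0.
  by rewrite (teq_idr (diag_type f)) (teq_idl (diag_type f)).
- move=> W X Y Z; rewrite !diag_eqE /= !teq_id_tens -!pos_cat -!catA.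
  by rewrite !id_id.
- by move=> X Y; rewrite !diag_eqE /= !teq_id_tens -!pos_cat -!catA id_id.
- move=> X X' Y Y' f g; rewrite !diag_eqE /=.
  by_axiom (ax_sym_nat (diag_type f) (diag_type g)).
- move=> X Y; rewrite !diag_eqE /= pos_cat.
  by_axiom (ax_sym_invol (pos X) (pos Y)).
- move=> X Y Z; rewrite !diag_eqE /= -catA -(catA Y X) -(catA Y Z).
  have tXZ : has_type (cId Y ⊗ @Sym sg (pos X) (pos Z))
    (pos (Y ++ X ++ Z)) (pos (Y ++ Z ++ X)) by typecheck.
  have tXYZ : has_type (@Sym sg (pos X) (pos (Y ++ Z)))
    (pos (X ++ Y ++ Z)) (pos (Y ++ Z ++ X)) by typecheck.
  rewrite (teq_idr tXYZ) (teq_idl tXYZ) (teq_idl tXZ) pos_cat.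
  by_axiom (ax_hexagon (pos X) (pos Y) (pos Z)).
Qed.

End InternalHom.

Theorem theorem10 (sg : signature) :
  is_category (diag_cat sg) /\
  is_symmetric_monoidal (diag_monoidal sg) /\
  is_closed (diag_monoidal sg).
Proof.
split; first exact: diag_is_category.
split; [exact: diag_is_symmetric_monoidal | exact: diag_is_closed].
Qed.
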